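(* Let $R$ be an integral domain. Then the following statements hold. (1) If $R$ is a Prüfer domain, then $\omega_{R[X]}(I[X])=\omega_R(I)$ for every ideal $I$ of $R$. (2) If $R$ is a Dedekind domain, then $\omega_{R[[X]]}(I[[X]])=\omega_R(I)$ for every ideal $I$ of $R$.
   Context: All rings are commutative with identity $1\neq 0$. For an ideal $I$ of $R$, $I[X]$ (resp. $I[[X]]$) denotes the ideal of $R[X]$ (resp. $R[[X]]$) consisting of the polynomials (resp. formal power series) all of whose coefficients lie in $I$. For a positive integer $n$, a proper ideal $I$ of a ring $R$ is an $n$-absorbing ideal of $R$ if whenever $x_1\cdots x_{n+1}\in I$ for $x_1,\ldots,x_{n+1}\in R$, then there are $n$ of the $x_i$'s whose product is in $I$. For a proper ideal $I$ of $R$, $\omega_R(I)=\min\{n\geq 1 : I \text{ is an } n\text{-absorbing ideal of } R\}$, with $\omega_R(I)=\infty$ if $I$ is not $n$-absorbing for any positive integer $n$; moreover $\omega_R(R)=0$. *)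

(* Defs.v *)
From HB Require Import structures.
From mathcomp Require Export all_boot all_order all_algebra.
From mathcomp Require Export boolp classical_sets constructive_ereal.

Set Implicit Arguments.
Unset Strict Implicit.
Unset Printing Implicit Defensive.

Import GRing.Theory.
Local Open Scope classical_set_scope.
Local Open Scope ring_scope.

Section Ideals.
Variable R : comNzRingType.
Implicit Types (I P M : set R) (n : nat).

(* Unlike the idealr structure of MathComp, ideals here are Prop-valued and
   may be the whole ring. *)
Definition is_ideal I : Prop :=
  [/\ I 0, (forall x y, I x -> I y -> I (x + y))
    & (forall a x, I x -> I (a * x))].

Definition prime_ideal P : Prop :=
  [/\ is_ideal P, P <> setT & forall x y, P (x * y) -> P x \/ P y].

Definition maximal_ideal M : Prop :=
  [/\ is_ideal M, M <> setT
    & forall I, is_ideal I -> M `<=` I -> I = M \/ I = setT].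

Definition finitely_generated I : Prop :=
  exists (n : nat) (a : 'I_n -> R),
    I = [set x | exists c : 'I_n -> R, x = \sum_(i < n) c i * a i].

Definition noetherian : Prop := forall I, is_ideal I -> finitely_generated I.

Definition absorbing n I : Prop :=
  [/\ (0 < n)%N, is_ideal I, I <> setT
    & forall x : 'I_n.+1 -> R, I (\prod_(i < n.+1) x i) ->
        exists j : 'I_n.+1, I (\prod_(i < n.+1 | i != j) x i)].

(* Only the values n%:E and +oo of \bar nat occur. *)
Definition omega I : \bar nat :=
  if `[< I = setT >] then 0%N%:E
  else if pselect (exists n, `[< absorbing n I >]) is left ex
       then (ex_minn ex)%:E
       else +oo%E.

End Ideals.

Section Domains.
Variable R : idomainType.
Local Notation K := {fraction R}.
Local Notation iota := (@FracField.tofrac R).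

Definition fractional_ideal (F : set K) : Prop :=
  [/\ F 0, (forall x y, F x -> F y -> F (x + y)),
      (forall a x, F x -> F (iota a * x))
    & exists2 d : R, d != 0 & forall x, F x -> range iota (iota d * x)].

Definition mul_fractional (F G : set K) : set K :=
  [set x | exists (n : nat) (a b : 'I_n -> K),
     (forall i, F (a i) /\ G (b i)) /\ x = \sum_(i < n) a i * b i].

Definition invertible_ideal (I : set R) : Prop :=
  exists2 G : set K, fractional_ideal G
    & mul_fractional (iota @` I) G = range iota.

Definition prufer_domain : Prop :=
  forall I : set R, is_ideal I -> finitely_generated I -> I <> [set 0] ->
    invertible_ideal I.

Definition integrally_closed : Prop :=
  forall z : K, integralOver iota z -> range iota z.

(* Fields are included. *)
Definition dedekind_domain : Prop :=
  [/\ noetherian R, integrally_closed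
    & forall P : set R, prime_ideal P -> P <> [set 0] -> maximal_ideal P].

End Domains.

(* A record rather than an alias of nat -> R, so that the Cauchy product is not
   confused with the pointwise ring structure on functions. *)
Record fps (R : Type) := FPS { fps_coef : nat -> R }.

HB.instance Definition _ (R : Type) := [isNew for @fps_coef R].
HB.instance Definition _ (R : choiceType) := [Choice of fps R by <:].

Section PowerSeries.
Variable R : comNzRingType.
Implicit Types f g h : fps R.

Lemma fpsP f g : (forall n, fps_coef f n = fps_coef g n) -> f = g.
Proof. by case: f g => [f] [g] /= fg; congr FPS; apply/funext. Qed.

Definition fps0 : fps R := FPS (fun=> 0).
Definition fps_opp f : fps R := FPS (fun n => - fps_coef f n).
Definition fps_add f g : fps R := FPS (fun n => fps_coef f n + fps_coef g n).
Definition fps1 : fps R := FPS (fun n => (n == 0%N)%:R).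
Definition fps_mul f g : fps R :=
  FPS (fun n => \sum_(i < n.+1) fps_coef f i * fps_coef g (n - i)%N).

Fact fps_addA : associative fps_add.
Proof. by move=> f g h; apply: fpsP => n /=; rewrite addrA. Qed.
Fact fps_addC : commutative fps_add.
Proof. by move=> f g; apply: fpsP => n /=; rewrite addrC. Qed.
Fact fps_add0 : left_id fps0 fps_add.
Proof. by move=> f; apply: fpsP => n /=; rewrite add0r. Qed.
Fact fps_addN : left_inverse fps0 fps_opp fps_add.
Proof. by move=> f; apply: fpsP => n /=; rewrite addNr. Qed.

HB.instance Definition _ :=
  GRing.isZmodule.Build (fps R) fps_addA fps_addC fps_add0 fps_addN.

Let trunc n f : {poly R} := \poly_(i < n.+1) fps_coef f i.

Let coef_trunc n f i : (i <= n)%N -> (trunc n f)`_i = fps_coef f i.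
Proof. by rewrite coef_poly ltnS => ->. Qed.

Let fps_mul_trunc n f g i : (i <= n)%N ->
  fps_coef (fps_mul f g) i = (trunc n f * trunc n g)`_i.
Proof.
move=> le_in; rewrite coefM /=; apply: eq_bigr => j _.
rewrite !coef_trunc ?(leq_trans (leq_subr _ _)) //.
by rewrite (leq_trans _ le_in) // -ltnS.
Qed.

Fact fps_mulC : commutative fps_mul.
Proof.
by move=> f g; apply: fpsP => n; rewrite !(@fps_mul_trunc n) // mulrC.
Qed.

Fact fps_mulA : associative fps_mul.
Proof.
move=> f g h; apply: fpsP => n.
transitivity ((trunc n f * (trunc n g * trunc n h))`_n).
  rewrite coefM; apply: eq_bigr => i _.
  have le_in : (i <= n)%N by rewrite -ltnS.
  by rewrite (coef_trunc f le_in) (fps_mul_trunc g h (leq_subr i n)).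
rewrite mulrA coefM; apply: eq_bigr => i _.
have le_in : (i <= n)%N by rewrite -ltnS.
by rewrite (coef_trunc h (leq_subr i n)) (fps_mul_trunc f g le_in).
Qed.

Fact fps_mul1 : left_id fps1 fps_mul.
Proof.
move=> f; apply: fpsP => n /=.
by rewrite big_ord_recl /= mul1r subn0 big1 ?addr0 // => i _; rewrite mul0r.
Qed.

Fact fps_mulDl : left_distributive fps_mul fps_add.
Proof.
move=> f g h; apply: fpsP => n /=; rewrite -big_split /=.
by apply: eq_bigr => i _; rewrite mulrDl.
Qed.

Fact fps_1neq0 : fps1 != 0 :> fps R.
Proof.
apply/eqP => /(congr1 (fun f => fps_coef f 0%N)) /= /eqP.
by rewrite oner_eq0.
Qed.

HB.instance Definition _ := GRing.Zmodule_isComNzRing.Build (fps R)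
  fps_mulA fps_mulC fps_mul1 fps_mulDl fps_1neq0.

End PowerSeries.

Definition poly_ideal (R : comNzRingType) (I : set R) : set {poly R} :=
  [set p | forall i : nat, I p`_i].

Definition fps_ideal (R : comNzRingType) (I : set R) : set (fps R) :=
  [set f | forall i : nat, I (fps_coef f i)].

(* Main.v *)
(* Only the passage from [I] to [I[X]] or [I[[X]]] is at stake.  In a Prufer
   domain the contents of polynomials are locally principal, and so are those
   of power series over a Dedekind domain.  Let [f_0 ... f_n] lie in [I[[X]]],
   and suppose that no subproduct [prod_(i != j) f_i] does.  Choose a maximal
   ideal [M_j] containing all [t] with [t prod_(i != j) f_i] in [I[[X]]], and
   [x_i] in the content of [f_i] generating it locally at each of the finitely
   many [M_j].  Then [x_0 ... x_n] is in [I], hence so is [prod_(i != j) x_i]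
   for some [j], and this contradicts the choice of [M_j] because [f_i] is
   locally a multiple of [x_i] there. *)
From HB Require Import structures.
Require Import Defs.

Set Implicit Arguments.
Unset Strict Implicit.
Unset Printing Implicit Defensive.

Import GRing.Theory.
Local Open Scope classical_set_scope.
Local Open Scope ring_scope.

(** * Ideals, maximal ideals and local generators *)

Section IdealTheory.
Variable R : comNzRingType.
Implicit Types (I J M P : set R) (F : set (set R)).

Lemma ideal0 I : is_ideal I -> I 0.
Proof. by case. Qed.

Lemma idealD I x y : is_ideal I -> I x -> I y -> I (x + y).
Proof. by case=> _ + _; apply. Qed.

Lemma idealMl I a x : is_ideal I -> I x -> I (a * x).
Proof. by case=> _ _; apply. Qed.

Lemma idealMr I a x : is_ideal I -> I x -> I (x * a).
Proof. by rewrite mulrC; apply: idealMl. Qed.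

Lemma idealB I x y : is_ideal I -> I x -> I y -> I (x - y).
Proof.
by move=> idI Ix Iy; rewrite -mulN1r; apply: idealD => //; apply: idealMl.
Qed.

Lemma ideal_sum I (T : Type) (r : seq T) (Q : pred T) (f : T -> R) :
  is_ideal I -> (forall i, Q i -> I (f i)) -> I (\sum_(i <- r | Q i) f i).
Proof.
move=> idI If; elim/big_ind: _ => //; first exact: ideal0.
by move=> x y; apply: idealD.
Qed.

Lemma ideal_proper I : is_ideal I -> I <> setT <-> ~ I 1.
Proof.
move=> idI; split=> [nT I1|nI1 IT]; last by apply: nI1; rewrite IT.
by apply: nT; apply/seteqP; split=> // x _; rewrite -[x]mulr1; apply: idealMl.
Qed.

Lemma ideal_scale (c : R) I : is_ideal I -> is_ideal [set t | I (t * c)].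
Proof.
move=> idI; split=> [|x y Ix Iy|a x Ix] /=.
- by rewrite mul0r; apply: ideal0.
- by rewrite mulrDl; apply: idealD.
- by rewrite -mulrA; apply: idealMl.
Qed.

Lemma ideal_chain_union F : F !=set0 -> (forall I, F I -> is_ideal I) ->
  total_on F subset -> is_ideal (\bigcup_(I in F) I).
Proof.
move=> [I0 FI0] idF totF; split.
- by exists I0 => //; apply: ideal0; apply: idF.
- move=> x y [I FI Ix] [J FJ Jy]; case: (totF I J FI FJ) => sub.
  + by exists J => //; apply: idealD => //; [apply: idF|apply: sub].
  + by exists I => //; apply: idealD => //; [apply: idF|apply: sub].
- by move=> a x [I FI Ix]; exists I => //; apply: idealMl => //; apply: idF.
Qed.

Lemma exists_maximal_over F I : F I ->
    (forall G, G !=set0 -> G `<=` F -> total_on G subset ->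
      F (\bigcup_(J in G) J)) ->
  exists M, [/\ F M, I `<=` M & forall J, F J -> M `<=` J -> J = M].
Proof.
move=> FI chainF; pose Q J := J = set0 \/ F J /\ I `<=` J.
have [G GQ totG|M [QM maxM]] := @Zorn_bigcup R Q.
  have [[J GJ J0]|all0] := pselect (exists2 J, G J & J <> set0); last first.
    left; apply/seteqP; split=> // x [J GJ Jx]; case: all0; exists J => //.
    by move=> J0; rewrite J0 in Jx.
  right; have -> : \bigcup_(J in G) J
      = \bigcup_(J in G `&` [set J | J <> set0]) J.
    apply/seteqP; split=> x [K]; last by case=> GK _ Kx; exists K.
    move=> GK Kx; exists K => //; split=> // K0; by rewrite K0 in Kx.
  split.
    apply: chainF; first by exists J.
    - by move=> K [/GQ [|[]]].
    - by move=> K L [GK _] [GL _]; apply: totG.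
  case: (GQ J GJ) => [//|[_ IJ]] x /IJ Jx; by exists J.
have max J : F J -> I `<=` J -> M `<=` J -> J = M.
  move=> FJ IJ MJ; apply: contrapT => nJM; apply: (maxM J); last by right.
  by rewrite properEneq; split=> //; apply/eqP => MJ_eq; apply: nJM.
case: QM => [M0|[FM IM]]; last first.
  by exists M; split=> // J FJ MJ; apply: max => //; apply: subset_trans MJ.
have IM : I = M by apply: max => //; rewrite M0.
by exists I; split=> // J FJ IJ; rewrite IM; apply: max => //; rewrite -IM.
Qed.

Lemma exists_maximal_ideal I : is_ideal I -> I <> setT ->
  exists2 M, maximal_ideal M & I `<=` M.
Proof.
move=> idI /(ideal_proper idI) nI1.
have [||M [[idM nM1] IM maxM]] :=
    @exists_maximal_over [set J | is_ideal J /\ ~ J 1] I.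
- by [].
- move=> G G0 GF totG; split; first by apply: ideal_chain_union => // J /GF[].
  by move=> [J /GF[]].
exists M => //; split=> //; first exact/(ideal_proper idM).
move=> J idJ MJ; have [->|/(ideal_proper idJ) nJ1] := pselect (J = setT).
  by right.
by left; apply: maxM.
Qed.

(** The union of a chain is finitely generated, and its finitely many generators already lie in one
    member, so the union is that member. *)
Lemma noetherian_maximal F : noetherian R -> F !=set0 ->
    (forall I, F I -> is_ideal I) ->
  exists2 M, F M & forall J, F J -> M `<=` J -> J = M.
Proof.
move=> noethR [I FI] idF.
have [||M [FM _ maxM]] := @exists_maximal_over F I; [by []| |by exists M].
move=> G G0 GF totG; set U := \bigcup_(J in G) J.
have idU : is_ideal U by apply: ideal_chain_union => // J /GF; apply: idF.
have [n [a Ua]] := noethR U idU.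
suff [J GJ Ja] : exists2 J, G J & forall i, J (a i).
  suff -> : U = J by apply: GF.
  apply/seteqP; split=> [x|x Jx]; last by exists J.
  by rewrite Ua => -[c ->]; apply: ideal_sum => [|i _];
     [|apply: idealMl => //]; apply/idF/GF.
have Uai i : U (a i).
  rewrite Ua; exists (fun j => (j == i)%:R).
  rewrite (bigD1 i) //= eqxx mul1r big1 ?addr0 // => j /negPf->.
  by rewrite mul0r.
suff /(_ n) [J GJ Ja] : forall m,
    exists2 J, G J & forall i : 'I_n, (i < m)%N -> J (a i).
  by exists J => // i; apply: Ja.
elim=> [|m [J GJ Ja]]; first by have [J GJ] := G0; exists J.
have [lt_mn|le_nm] := ltnP m n; last first.
  by exists J => // i _; apply: Ja; apply: leq_trans le_nm.
have [K GK Kam] := Uai (Ordinal lt_mn).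
case: (totG J K GJ GK) => sub; [exists K|exists J] => // i;
  rewrite ltnS leq_eqVlt => /orP[/eqP im|im].
- by rewrite (_ : i = Ordinal lt_mn) //; apply: val_inj.
- by apply/sub/Ja.
- by apply: sub; rewrite (_ : i = Ordinal lt_mn) //; apply: val_inj.
- exact: Ja.
Qed.

Lemma maximal_prime M : maximal_ideal M -> prime_ideal M.
Proof.
move=> [idM nMT maxM]; split=> // x y Mxy.
have [Mx|nMx] := pselect (M x); [by left|right].
pose J : set R := [set z | exists2 m, M m & exists r, z = m + r * x].
have MJ : M `<=` J by move=> m Mm; exists m => //; exists 0; rewrite mul0r addr0.
have idJ : is_ideal J.
  split=> [|_ _ [m Mm [r ->]] [m' Mm' [r' ->]]|a _ [m Mm [r ->]]].
  - by apply: MJ; apply: ideal0.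
  - exists (m + m'); first exact: idealD.
    by exists (r + r'); rewrite mulrDl addrACA.
  - exists (a * m); first exact: idealMl.
    by exists (a * r); rewrite mulrDr mulrA.
case: (maxM J idJ MJ) => [JM|JT].
  case: nMx; rewrite -JM; exists 0; first exact: ideal0.
  by exists 1; rewrite mul1r add0r.
have [m Mm [r e1]] : J 1 by rewrite JT.
rewrite -[y]mul1r e1 mulrDl -mulrA.
by apply: idealD => //; [apply: idealMr|apply: idealMl].
Qed.

Lemma maximal_ideal_ideal M : maximal_ideal M -> is_ideal M.
Proof. by case. Qed.

Lemma prime_prod P (T : Type) (r : seq T) (Q : pred T) (f : T -> R) :
    prime_ideal P -> (forall i, Q i -> ~ P (f i)) ->
  ~ P (\prod_(i <- r | Q i) f i).
Proof.
move=> [idP nPT primeP] nPf; elim/big_ind: _ => //.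
  exact/(ideal_proper idP).
by move=> x y nPx nPy /primeP[].
Qed.

(** Applied to the ideal of all [t] with [t * c] in a given ideal, this lets membership of [c] be
    checked locally. *)
Lemma maximal_local I : is_ideal I ->
  (forall M, maximal_ideal M -> exists2 s, ~ M s & I s) -> I 1.
Proof.
move=> idI locI; apply: contrapT => /(ideal_proper idI).
move=> /(exists_maximal_ideal idI)[M maxM IM].
by have [s nMs /IM] := locI M maxM.
Qed.

(** Each [N j] contains an element outside [M], by maximality; the product of these stays outside
    [M] because [M] is prime. *)
Lemma maximal_separation M (n : nat) (N : nat -> set R) :
    maximal_ideal M -> (forall j, maximal_ideal (N j)) ->
    (forall j, (j < n)%N -> N j <> M) ->
  exists2 e, ~ M e & forall j, (j < n)%N -> N j e.
Proof.
move=> maxM maxN; have [idM nMT primeM] := maximal_prime maxM.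
elim: n => [|n IHn] NM.
  by exists 1 => //; apply/(ideal_proper idM).
have [j lt_jn|e nMe Ne] := IHn; first by apply: NM; apply: ltnW.
have [d nMd Nd] : exists2 d, ~ M d & N n d.
  apply: contrapT => nd; case: (maxN n) => _ nNT maxNn.
  have /(maxNn _ idM)[/esym/(NM n (leqnn _))//|//] : N n `<=` M.
  by move=> d Nd; apply: contrapT => nMd; apply: nd; exists d.
exists (e * d); first by move/primeM => [].
move=> j; rewrite ltnS leq_eqVlt => /orP[/eqP->|/Ne Nje].
  by apply: idealMl => //; apply: maximal_ideal_ideal.
by apply: idealMr => //; apply: maximal_ideal_ideal.
Qed.

(* [x] generates [J] after localization at [M], uniformly over [J]. *)
Definition local_generator M J x :=
  exists2 s, ~ M s & forall y, J y -> exists r, s * y = r * x.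

Definition locally_principal J :=
  forall M, maximal_ideal M -> exists2 a, J a & local_generator M J a.

(** Induction on [n]. If [x] fails to generate at the new ideal [N n], add [e * a], where [a]
    generates there and [e] lies in the earlier ideals but not in [N n]. At [N n] the sum is a unit
    times [a]; at each earlier ideal it is a unit times [x]. *)
Lemma semilocal_generator J (n : nat) (N : nat -> set R) :
    is_ideal J -> locally_principal J -> (forall j, maximal_ideal (N j)) ->
  exists2 x, J x & forall j, (j < n)%N -> local_generator (N j) J x.
Proof.
move=> idJ princJ maxN; elim: n => [|n [x Jx genx]].
  by exists 0 => //; apply: ideal0.
have extend : local_generator (N n) J x ->
    exists2 x, J x & forall j, (j < n.+1)%N -> local_generator (N j) J x.
  move=> gennx; exists x => // j; rewrite ltnS leq_eqVlt => /orP[/eqP->//|].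
  exact: genx.
have [/extend//|ngenx] := pselect (local_generator (N n) J x).
have [j lt_jn NjM|e nMe Ne] := @maximal_separation (N n) n N (maxN n) maxN.
  by apply: ngenx; rewrite -NjM; apply: genx.
have [idM _ primeM] := maximal_prime (maxN n).
have [a Ja [t nMt gena]] := princJ (N n) (maxN n).
exists (x + e * a); first by apply: idealD => //; apply: idealMl.
move=> j; rewrite ltnS leq_eqVlt => /orP[/eqP->|lt_jn].
  have [r tx] := gena x Jx.
  have Mr : N n r.
    apply: contrapT => nMr; apply: ngenx; exists (r * t).
      by move/primeM => [].
    move=> y /gena[q ty]; exists (q * t).
    by rewrite -mulrA ty mulrCA -tx mulrA.
  have nMte : ~ N n (t * e) by move/primeM => [].
  (* From [t * x = r * a] one gets [t * (x + e * a) = (r + t * e) * a], and [r + t * e] is a unit at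
     [N n] since [r] lies in it and [t * e] does not. *)
  exists ((r + t * e) * t).
    move/primeM => [Mrte|//]; apply: nMte.
    by rewrite -[t * e](addKr r) addrC; apply: idealB.
  move=> y /gena[q ty]; exists (q * t).
  rewrite -mulrA ty -mulrA mulrDr tx mulrCA; congr (q * _).
  by rewrite mulrDl mulrA.
have [idNj _ primeNj] := maximal_prime (maxN j).
have [s nNs gens] := genx j lt_jn.
have [r sa] := gens a Ja.
(* Here [s * (x + e * a) = (s + e * r) * x], with [s] outside and [e] inside [N j]. *)
exists ((s + e * r) * s).
  move/primeNj => [Nser|//]; apply: nNs.
  rewrite -(addrK (e * r) s); apply: idealB => //.
  by apply: idealMr => //; apply: Ne.
move=> y /gens[q sy]; exists (q * s).
rewrite -mulrA sy -mulrA mulrDr [s * (e * a)]mulrCA sa mulrCA; congr (q * _).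
by rewrite mulrDl mulrA.
Qed.

End IdealTheory.

Lemma ideal_preimage (R S : comNzRingType) (phi : {rmorphism R -> S})
    (J : set S) :
  is_ideal J -> is_ideal (phi @^-1` J).
Proof.
move=> idJ; split=> [|x y Jx Jy|a x Jx] /=.
- by rewrite rmorph0; apply: ideal0.
- by rewrite rmorphD; apply: idealD.
- by rewrite rmorphM; apply: idealMl.
Qed.

(** * Contents of power series and absorption of products *)

Section PowerSeriesContent.
Variable R : comNzRingType.
Implicit Types (I M : set R) (f g : fps R) (p : {poly R}).

Definition poly_fps p : fps R := FPS (fun i => p`_i).

Fact poly_fps_zmod_morphism : zmod_morphism poly_fps.
Proof. by move=> p q; apply: fpsP => i /=; rewrite coefB. Qed.

Fact poly_fps_monoid_morphism : monoid_morphism poly_fps.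
Proof.
split=> [|p q]; apply: fpsP => i /=; first by rewrite coef1.
by rewrite coefM.
Qed.

HB.instance Definition _ :=
  GRing.isZmodMorphism.Build {poly R} (fps R) poly_fps poly_fps_zmod_morphism.
HB.instance Definition _ :=
  GRing.isMonoidMorphism.Build {poly R} (fps R) poly_fps
    poly_fps_monoid_morphism.

Definition fps_const : R -> fps R := poly_fps \o polyC.

HB.instance Definition _ := GRing.RMorphism.on fps_const.

Lemma fps_coef_constM c f i : fps_coef (fps_const c * f) i = c * fps_coef f i.
Proof.
transitivity (\sum_(j < i.+1) (c%:P)`_j * fps_coef f (i - j)%N) => //.
rewrite big_ord_recl /= coefC eqxx subn0 big1 ?addr0 // => j _.
by rewrite coefC mul0r.
Qed.

Lemma fps_ideal_ideal I : is_ideal I -> is_ideal (fps_ideal I).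
Proof.
move=> idI; split=> [i|f g If Ig i|f g Ig i] /=; first exact: ideal0.
- by apply: idealD.
- by apply: ideal_sum => // j _; apply: idealMl.
Qed.

Lemma fps_ideal_const I c : is_ideal I -> I c -> fps_ideal I (fps_const c).
Proof.
by move=> idI Ic i /=; rewrite coefC; case: ifP => // _; apply: ideal0.
Qed.

(** Take the first coefficients outside [M], at indices [k] and [l]. In the coefficient of index
    [k + l] of the product, every other term has a factor of smaller index, hence in [M]. *)
Lemma fps_ideal_prime M : prime_ideal M -> prime_ideal (fps_ideal M).
Proof.
move=> [idM nMT primeM]; have idfM := fps_ideal_ideal idM.
split=> // [|f g Mfg].
  by apply/(ideal_proper idfM) => /(_ 0%N); apply/(ideal_proper idM).
apply: contrapT => /not_orP[nMf nMg].
have least h : ~ fps_ideal M h -> exists2 k, ~ M (fps_coef h k)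
    & forall i, (i < k)%N -> M (fps_coef h i).
  move=> /existsNP[k0 nMk0].
  have ex : exists k, `[< ~ M (fps_coef h k) >] by exists k0; apply/asboolP.
  case: (ex_minnP ex) => k /asboolP nMk mink; exists k => // i lt_ik.
  apply: contrapT => nMi.
  have /mink : `[< ~ M (fps_coef h i) >] by apply/asboolP.
  by rewrite leqNgt lt_ik.
have [[k nMk Mk] [l nMl Ml]] := (least f nMf, least g nMg).
have lt_k : (k < (k + l).+1)%N by rewrite ltnS leq_addr.
have /(primeM _ _)[//|//] : M (fps_coef f k * fps_coef g l).
have -> : fps_coef f k * fps_coef g l =
    fps_coef (f * g) (k + l)
    - \sum_(i < (k + l).+1 | i != Ordinal lt_k)
        fps_coef f i * fps_coef g (k + l - i)%N.
  rewrite [fps_coef (f * g) _](bigD1 (Ordinal lt_k)) //=.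
  by rewrite addrK addKn.
apply: idealB => //; apply: ideal_sum => // i ik.
have [lt_ik|le_ki] := ltnP i k; first by apply: idealMr => //; apply: Mk.
apply: idealMl => //; apply: Ml.
have lt_ki : (k < i)%N by rewrite ltn_neqAle le_ki eq_sym andbT.
by rewrite ltn_subLR ?ltn_add2r // -ltnS.
Qed.

(** The ideal generated by the coefficients, as an intersection: a property defining an ideal holds
    on the content once it holds for each coefficient. *)
Definition content f : set R :=
  [set x | forall I, is_ideal I -> (forall i, I (fps_coef f i)) -> I x].

Lemma content_ideal f : is_ideal (content f).
Proof.
split=> [I idI If|x y cx cy I idI If|a x cx I idI If]; first exact: ideal0.
- by apply: idealD; [|apply: cx|apply: cy].
- by apply: idealMl => //; apply: cx.
Qed.

Lemma fps_coef_content f i : content f (fps_coef f i).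
Proof. by move=> I _; apply. Qed.

Definition locally_principal_content f :=
  forall M, maximal_ideal M ->
    exists k, local_generator M (content f) (fps_coef f k).

Lemma local_generator_content f a s :
    (forall i, exists r, s * fps_coef f i = r * a) ->
  forall y, content f y -> exists r, s * y = r * a.
Proof.
move=> gena y cy; apply: (cy [set y | exists r, s * y = r * a]) => //.
split=> [|y1 y2 [r1 e1] [r2 e2]|b y1 [r e]].
- by exists 0; rewrite mulr0 mul0r.
- by exists (r1 + r2); rewrite mulrDr e1 e2 mulrDl.
- by exists (b * r); rewrite mulrCA e mulrA.
Qed.

Lemma local_generator_factor M f a : local_generator M (content f) a ->
  exists s g, ~ M s /\ fps_const s * f = fps_const a * g.
Proof.
move=> [s nMs gena].
have /choice[r sf] : forall i, exists r, s * fps_coef f i = r * a.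
  by move=> i; apply: gena; apply: fps_coef_content.
exists s, (FPS r); split=> //; apply: fpsP => i.
by rewrite !fps_coef_constM /= sf mulrC.
Qed.

Lemma local_coef_factor M f k :
    local_generator M (content f) (fps_coef f k) ->
  exists s g, [/\ ~ M s, ~ fps_ideal M g
    & fps_const s * f = fps_const (fps_coef f k) * g].
Proof.
move=> [s nMs gena].
(* The clause at [i = k] makes the [k]-th coefficient of the quotient series equal to [s], which
   keeps that series out of [fps_ideal M]. *)
have /choice[r sf] : forall i, exists r,
    s * fps_coef f i = r * fps_coef f k /\ (i = k -> r = s).
  move=> i; have [->|ik] := eqVneq i k; first by exists s.
  have [r ?] := gena _ (@fps_coef_content f i); exists r; split=> // e.
  by rewrite e eqxx in ik.
exists s, (FPS r); split=> //.
  by move/(_ k); have [_ /= ->] := sf k.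
by apply: fpsP => i; rewrite !fps_coef_constM /= (sf i).1 mulrC.
Qed.

(* The inclusion c(f_1) ... c(f_m) <= c(f_1 ... f_m), checked locally: at a
   maximal ideal [M], each [f_i] is a generator of its content times a series
   that is nonzero modulo [M]. *)
Lemma prod_content (T : finType) I (f : T -> fps R) (x : T -> R) :
    is_ideal I -> (forall i, locally_principal_content (f i)) ->
    (forall i, content (f i) (x i)) ->
  fps_ideal I (\prod_i f i) -> I (\prod_i x i).
Proof.
move=> idI princf cx If; rewrite -[\prod_i x i]mul1r.
apply: (maximal_local (ideal_scale (\prod_i x i) idI)) => M maxM.
have primeM := maximal_prime maxM; have [idM _ primeM2] := primeM.
have /choice[k genk] := fun i => princf i M maxM.
have /choice[s /choice[g sfg]] := fun i => local_coef_factor (genk i).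
have /choice[t /choice[r tx]] : forall i, exists t r,
    ~ M t /\ t * x i = r * fps_coef (f i) (k i).
  move=> i; have [t nMt gen] := genk i; have [r tx] := gen _ (cx i).
  by exists t, r.
have : ~ fps_ideal M (\prod_i g i).
  by apply: prime_prod => [|i _]; [apply: fps_ideal_prime|case: (sfg i)].
move=> /existsNP[l nMl].
(* The [t i] turn each [x i] into a multiple of the generating coefficient; the product of these
   coefficients times coefficient [l] of [\prod_i g i] is a coefficient of
   [\prod_i fps_const (s i) * f i]. *)
exists (fps_coef (\prod_i g i) l * \prod_i t i).
  move/primeM2 => [//|]; apply: prime_prod => // i _; by case: (tx i).
rewrite /= -mulrA.
have -> : (\prod_i t i) * \prod_i x i
    = (\prod_i r i) * \prod_i fps_coef (f i) (k i).
  by rewrite -!big_split /=; apply: eq_bigr => i _; case: (tx i).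
rewrite mulrCA; apply: idealMl => //; rewrite mulrC.
rewrite -fps_coef_constM rmorph_prod -big_split /=.
under eq_bigr => i _ do case: (sfg i) => _ _ <-.
by rewrite big_split /=; exact: (idealMl _ (fps_ideal_ideal idI) If l).
Qed.

Lemma absorbing_prod n I (f : 'I_n.+1 -> fps R) :
    absorbing n I -> (forall i, locally_principal_content (f i)) ->
    fps_ideal I (\prod_i f i) ->
  exists j, fps_ideal I (\prod_(i | i != j) f i).
Proof.
move=> [_ idI _ absI] princf If; apply: contrapT => /forallNP nIf.
have idfI := fps_ideal_ideal idI.
have /choice[N maxN] : forall j, exists M, maximal_ideal M /\
    [set t | fps_ideal I (fps_const t * \prod_(i | i != j) f i)] `<=` M.
  move=> j.
  have idQ := ideal_preimage fps_const
    (ideal_scale (\prod_(i | i != j) f i) idfI).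
  have [|M maxM QM] := exists_maximal_ideal idQ.
    by apply/(ideal_proper idQ); rewrite /= rmorph1 mul1r.
  by exists M.
have /choice[x genx] : forall i, exists x, content (f i) x /\
    forall j, local_generator (N j) (content (f i)) x.
  move=> i.
  have princ : locally_principal (content (f i)).
    move=> M /(princf i)[k gen].
    by exists (fps_coef (f i) k) => //; apply: fps_coef_content.
  have [j|x cx genx] := semilocal_generator n.+1 (N := N \o inord)
    (@content_ideal (f i)) princ; first by case: (maxN (inord j)).
  exists x; split=> // j; have := genx j (ltn_ord j).
  by rewrite /= inord_val.
have [j Ixj] : exists j, I (\prod_(i | i != j) x i).
  by apply: absI; apply: prod_content If => // i; case: (genx i).
have /choice[s /choice[g sfg]] :=
  fun i => local_generator_factor ((genx i).2 j).
have [maxNj sub] := maxN j.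
(* Multiplying [\prod_(i | i != j) f i] by these [s i] gives the constant [\prod_(i | i != j) x i],
   which is in [I], times a series. *)
suff : N j (\prod_(i | i != j) s i).
  by apply: prime_prod; [apply: maximal_prime|move=> i _; case: (sfg i)].
apply: sub => /=; rewrite rmorph_prod -big_split /=.
under eq_bigr do rewrite (sfg _).2.
rewrite big_split /= -rmorph_prod.
by apply: (idealMr _ idfI); apply: fps_ideal_const.
Qed.

End PowerSeriesContent.

(** * Comparison of [omega] along ring morphisms *)

Section OmegaTransfer.
Variables R S : comNzRingType.
Implicit Types (I : set R) (J : set S).

Lemma proper_preimage (phi : {rmorphism R -> S}) J : is_ideal J ->
  phi @^-1` J <> setT <-> J <> setT.
Proof.
move=> idJ; rewrite (ideal_proper idJ) (ideal_proper (ideal_preimage phi idJ)).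
by rewrite /= rmorph1.
Qed.

Lemma absorbing_preimage (phi : {rmorphism R -> S}) n J :
  absorbing n J -> absorbing n (phi @^-1` J).
Proof.
move=> [n0 idJ nJT absJ]; split=> //; first exact: ideal_preimage.
  exact/(proper_preimage phi idJ).
by move=> x /=; rewrite rmorph_prod => /absJ[j]; rewrite -rmorph_prod; exists j.
Qed.

Lemma eq_omega I J : (I <> setT <-> J <> setT) ->
  (forall n, absorbing n I <-> absorbing n J) -> omega I = omega J.
Proof.
move=> eqT eqabs; rewrite /omega.
have -> : (I = setT) = (J = setT).
  by apply/propext; split=> e; apply: contrapT => /eqT.
(* Abstracting the predicate reduces the goal to an equality of predicates, with no rewriting under
   the proof given to [ex_minn]. *)
pose om (P : pred nat) : \bar nat :=
  if pselect (exists n, P n) is left ex then (ex_minn ex)%:E else +oo%E.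
case: ifP => // _; congr (om _); apply/funext => n.
exact/asbool_equiv_eq.
Qed.

End OmegaTransfer.

Lemma fps_const_preimage (R : comNzRingType) (I : set R) : is_ideal I ->
  @fps_const R @^-1` fps_ideal I = I.
Proof.
move=> idI; apply/seteqP; split=> c; last exact: fps_ideal_const.
by move/(_ 0%N); rewrite /= coefC.
Qed.

(** * Locally principal contents over Prüfer and Dedekind domains *)

Section Domains.
Variable R : idomainType.
Local Notation K := {fraction R}.
Local Notation iota := (@FracField.tofrac R).
Implicit Types (I M : set R) (f : fps R) (p : {poly R}).

Lemma locally_principal_content0 : locally_principal_content (0 : fps R).
Proof.
move=> M [idM nMT _]; exists 0%N; exists 1; first exact/(ideal_proper idM).
by apply: local_generator_content => i; exists 0; rewrite mulr0 mul0r.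
Qed.

(** Multiply [v * f_k = s] by [f_i]: then [s * f_i = (v * f_i) * f_k], and [v * f_i] lies in the
    ring. *)
Lemma local_generator_inverse M f k s (v : K) :
    ~ M s -> v * iota (fps_coef f k) = iota s ->
    (forall i, range iota (v * iota (fps_coef f i))) ->
  local_generator M (content f) (fps_coef f k).
Proof.
move=> nMs vk vf; exists s => //; apply: local_generator_content => i.
have [r _ vi] := vf i; exists r; apply/eqP.
by rewrite -tofrac_eq !tofracM -vk vi mulrAC.
Qed.

(** If no coefficient generates at [M], every element of the inverse [G] of the coefficient ideal
    [J] sends all coefficients into [M]. Then [J G] lies in [M], although it contains 1. *)
Lemma prufer_locally_principal p :
  prufer_domain R -> locally_principal_content (poly_fps p).
Proof.
move=> pruferR; have [->|p0] := eqVneq p 0.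
  by rewrite rmorph0; apply: locally_principal_content0.
move=> M maxM; have idM := maximal_ideal_ideal maxM.
pose J := [set x |
  exists c : 'I_(size p) -> R, x = \sum_(i < size p) c i * p`_i].
have idJ : is_ideal J.
  split=> [|_ _ [c ->] [c' ->]|a _ [c ->]].
  - by exists (fun=> 0); rewrite big1 // => i _; rewrite mul0r.
  - exists (fun i => c i + c' i); rewrite -big_split /=.
    by apply: eq_bigr => i _; rewrite mulrDl.
  - exists (fun i => a * c i); rewrite mulr_sumr.
    by apply: eq_bigr => i _; rewrite mulrA.
have Jp i : J p`_i.
  have [lt_ip|le_pi] := ltnP i (size p); last first.
    by rewrite nth_default //; apply: ideal0.
  exists (fun j => (j == Ordinal lt_ip)%:R).
  rewrite (bigD1 (Ordinal lt_ip)) //= eqxx mul1r big1 ?addr0 // => j /negPf->.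
  by rewrite mul0r.
have J0 : J <> [set 0].
  move=> J0; have : J (lead_coef p) by apply: Jp.
  by rewrite J0 /= => /eqP; rewrite lead_coef_eq0; apply/negP.
have [|G [G0 _ _ _] JG] := pruferR J idJ _ J0.
  by exists (size p), (fun i => p`_i).
have GJ v x : G v -> J x -> range iota (v * iota x).
  move=> Gv Jx; rewrite -JG; exists 1%N, (fun=> iota x), (fun=> v).
  by split; [split=> //; exists x|rewrite big_ord1 mulrC].
apply: contrapT => /forallNP ngen.
have Mv v i : G v -> (iota @` M) (v * iota p`_i).
  move=> Gv; have [s _ sE] := GJ v _ Gv (Jp i); exists s => //.
  apply: contrapT => nMs; apply: (ngen i).
  apply: (@local_generator_inverse M (poly_fps p) i s v nMs (esym sE)) => j.
  by apply: GJ => //; apply: Jp.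
have MD (x y : K) : (iota @` M) x -> (iota @` M) y -> (iota @` M) (x + y).
  move=> [m Mm <-] [m' Mm' <-]; exists (m + m'); first exact: idealD.
  exact: tofracD.
have M0 : (iota @` M) 0 by exists 0; [apply: ideal0|apply: tofrac0].
have [n [a [b [Gab e1]]]] : mul_fractional (iota @` J) G 1.
  by rewrite JG; exists 1 => //; apply: tofrac1.
have [m Mm] : (iota @` M) 1.
  rewrite e1; elim/big_ind: _ => // i _; have [[_ [c ->] <-] Gb] := Gab i.
  rewrite rmorph_sum mulr_suml; elim/big_ind: _ => // j _.
  have [m Mm mE] := Mv _ j Gb; exists (c j * m); first exact: idealMl.
  by rewrite tofracM mE rmorphM -mulrA [b i * _]mulrC.
rewrite -tofrac1 => /eqP; rewrite tofrac_eq => /eqP m1.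
by case: maxM => _ /(ideal_proper idM) + _; apply; rewrite -m1.
Qed.

(** Determinant trick: [b / d] maps [L] into itself, so it is an eigenvalue of a matrix over the
    ring, hence a root of its monic characteristic polynomial. *)
Lemma integral_over_stable (L : set R) b d : d != 0 -> L d ->
    finitely_generated L ->
    (forall x, L x -> exists2 y, L y & b * x = y * d) ->
  integralOver iota (iota b / iota d).
Proof.
move=> d0 Ld [n [a La]] stabL.
have d0' : iota d != 0 by rewrite tofrac_eq0.
have La_ i : L (a i).
  rewrite La; exists (fun j => (j == i)%:R).
  rewrite (bigD1 i) //= eqxx mul1r big1 ?addr0 // => j /negPf->.
  by rewrite mul0r.
have /choice[c cE] : forall i, exists c : 'I_n -> R,
    b * a i = (\sum_j c j * a j) * d.
  by move=> i; have [y] := stabL _ (La_ i); rewrite {1}La => -[c ->]; exists c.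
(* Transposed, since eigenvectors are row vectors. *)
pose A := \matrix_(i < n, j < n) c j i.
exists (char_poly A); first exact: char_poly_monic.
rewrite map_char_poly -eigenvalue_root_char; apply/eigenvalueP.
exists (\row_j iota (a j)).
  apply/rowP => j; rewrite !mxE mulrAC -tofracM cE tofracM mulfK //.
  rewrite rmorph_sum; apply: eq_bigr => i _.
  by rewrite !mxE mulrC -tofracM.
(* The eigenvector is nonzero: otherwise all generators of [L] vanish, and so does [d]. *)
apply: contraNneq d0 => a0.
move: Ld; rewrite La => -[e ->]; rewrite big1 // => i _.
move/rowP/(_ i): a0; rewrite !mxE => /eqP; rewrite tofrac_eq0 => /eqP->.
by rewrite mulr0.
Qed.

(* In a noetherian domain of dimension at most one, every maximal ideal
   containing [d != 0] is a colon ideal [(d) : b].  A colon ideal maximal among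
   those contained in [M] is prime, hence equal to [M]. *)
Lemma maximal_ideal_colon M d : noetherian R ->
    (forall P : set R, prime_ideal P -> P <> [set 0] -> maximal_ideal P) ->
    maximal_ideal M -> d != 0 -> M d ->
  exists b, M = [set x | exists r, b * x = r * d].
Proof.
move=> noethR dim1 maxM d0 Md.
have [idM nMT primeM] := maximal_prime maxM.
pose Q b := [set x | exists r, b * x = r * d].
have idQ b : is_ideal (Q b).
  split=> [|x y [r e] [r' e']|a x [r e]].
  - by exists 0; rewrite mulr0 mul0r.
  - by exists (r + r'); rewrite mulrDr e e' mulrDl.
  - by exists (a * r); rewrite mulrCA e mulrA.
have QS b c : Q b `<=` Q (b * c).
  by move=> x [r e]; exists (c * r); rewrite mulrAC e mulrC mulrA.
have [||_ [[b _ <-] QM] maxQ] :=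
    @noetherian_maximal R [set J | range Q J /\ J `<=` M] noethR.
- exists (Q 1); split; first by exists 1.
  by move=> x [r]; rewrite mul1r => ->; apply: idealMl.
- by move=> J [[b _ <-] _].
have QMeq c : Q (b * c) `<=` M -> Q (b * c) = Q b.
  by move=> QcM; apply: maxQ => //; split=> //; exists (b * c).
exists b; have [||_ _ maxQb] := dim1 (Q b).
- split=> //; first apply/(ideal_proper (idQ b)) => /QM.
    exact/(ideal_proper idM).
  move=> x y [r e].
  (* If [Q (b * x)] lies in [M], it equals [Q b] and contains [y]. Otherwise it has some [t] outside
     [M]; then [Q (b * t)] lies in [M], so it equals [Q b], and it contains [x]. *)
  have [sub|] := pselect (Q (b * x) `<=` M).
    by right; rewrite -(QMeq x sub); exists r; rewrite -mulrA.
  move=> /existsNP[t /not_implyP[[q qE] nMt]]; left.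
  rewrite -(QMeq t); first by exists q; rewrite mulrAC.
  move=> u [w wE]; have [|//|//] := primeM u t.
  by apply: QM; exists w; rewrite -wE mulrA mulrAC.
- move=> Q0; have : Q b d by exists b.
  by rewrite Q0 /= => /eqP; apply/negP.
by case: (maxQb M idM QM).
Qed.

(** If no coefficient generates at [M], the inverse of the content multiplies the content into [M].
    Writing [M] as a colon ideal [(d) : b], the fraction [b / d] then stabilizes [L], so it is
    integral and lies in the ring, which puts 1 in [M]. *)
Lemma dedekind_locally_principal f :
  dedekind_domain R -> locally_principal_content f.
Proof.
move=> [noethR intR dim1].
have [f0|nf0] := pselect (forall i, fps_coef f i = 0).
  have -> : f = 0 by apply: fpsP.
  exact: locally_principal_content0.
have [k0 /eqP d0] : exists k, fps_coef f k <> 0 by apply/existsNP.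
move=> M maxM; have idM := maximal_ideal_ideal maxM.
set d := fps_coef f k0 in d0.
apply: contrapT => /forallNP ngen.
(* [L] is [d] times the inverse of the content of [f]. *)
pose L := [set x | forall k, exists r, x * fps_coef f k = r * d].
have idL : is_ideal L.
  split=> [k|x y Lx Ly k|a x Lx k].
  - by exists 0; rewrite !mul0r.
  - have [[r e] [r' e']] := (Lx k, Ly k).
    by exists (r + r'); rewrite !mulrDl e e'.
  - by have [r e] := Lx k; exists (a * r); rewrite -!mulrA e.
have d0' : iota d != 0 by rewrite tofrac_eq0.
have divd x y r : x * y = r * d -> iota x / iota d * iota y = iota r.
  by move=> e; rewrite mulrAC -tofracM e tofracM mulfK.
have LM x k r : L x -> x * fps_coef f k = r * d -> M r.
  move=> Lx /divd e; apply: contrapT => nMr; apply: (ngen k).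
  apply: (local_generator_inverse nMr e) => i.
  by have [q /divd qE] := Lx i; exists q.
have Ld : L d by move=> k; exists (fps_coef f k); rewrite mulrC.
have [b ME] := maximal_ideal_colon noethR dim1 maxM d0 (LM d k0 d Ld erefl).
have [|c _ cE] := intR (iota b / iota d).
  apply: (integral_over_stable d0 Ld (noethR L idL)) => x Lx.
  (* The coefficient at [k0] is [d] itself, so the quotient [r] there is [x]. *)
  have : M x by apply: (LM x k0 x).
  rewrite ME => -[y yE]; exists y => // k.
  have [r rE] := Lx k; have := LM x k r Lx rE; rewrite ME => -[q qE].
  exists q; apply: (mulIf d0).
  by rewrite mulrAC -yE -[b * x * _]mulrA rE mulrA qE.
case: maxM => _ /(ideal_proper idM) nM1 _; apply: nM1; rewrite ME.
exists c; rewrite mulr1; apply/eqP.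
by rewrite -tofrac_eq tofracM cE divfK.
Qed.

End Domains.

Theorem corollary11 (R : idomainType) :
  (prufer_domain R ->
     forall I : set R, is_ideal I -> omega (poly_ideal I) = omega I) /\
  (dedekind_domain R ->
     forall I : set R, is_ideal I -> omega (fps_ideal I) = omega I).
Proof.
split=> domR I idI; have idfI := fps_ideal_ideal idI;
  have constI := fps_const_preimage idI.
- have polyI : polyC @^-1` poly_ideal I = I by [].
  (* [poly_ideal I] is by conversion the preimage of [fps_ideal I] under [poly_fps], so products of
     polynomials can be treated as power series. *)
  have idpI : is_ideal (poly_ideal I) := ideal_preimage (@poly_fps R) idfI.
  have polyT : poly_ideal I <> setT <-> I <> setT.
    by rewrite -[in X in _ <-> X]polyI proper_preimage.
  apply: eq_omega => // n; split=> [absI|absI].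
    by rewrite -polyI; apply: absorbing_preimage.
  have [n0 _ nIT _] := absI; split=> //; first exact/polyT.
  move=> p Ip.
  have [|||j Ij] := @absorbing_prod R n I (fun i => poly_fps (p i)).
  - exact: absI.
  - by move=> i; apply: prufer_locally_principal.
  - by rewrite -rmorph_prod.
  by exists j; move: Ij; rewrite -rmorph_prod.
- have fpsT : fps_ideal I <> setT <-> I <> setT.
    by rewrite -[in X in _ <-> X]constI proper_preimage.
  apply: eq_omega => // n; split=> [absI|absI].
    by rewrite -constI; apply: absorbing_preimage.
  have [n0 _ nIT _] := absI; split=> //; first exact/fpsT.
  by move=> f; apply: absorbing_prod => // i; apply: dedekind_locally_principal.
Qed.
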